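(* Let $\mathcal{R}\subset\mathbb{R}_+^K$ be a compact, convex and coordinate-convex rate region, and let $\{\mathbf{A}^L\}_{L\in\mathbb{N}}$ be a sequence of arrival processes such that: (i) $\{\mathbf{A}^L\}$ satisfies a sample path LDP in $\mathcal{D}^K_{\boldsymbol{\mu}}$, equipped with the scaled uniform topology, with rate function $I^\sharp$; for every $t\in\mathbb{N}$, $\{\mathbf{A}^L|_{(0,t]}\}$ satisfies an LDP in $\mathbb{R}_+^{K\times t}$ (product topology) with rate function $I^\sharp_t$; and $I^\sharp(\mathbf{a})=\sup_{t\in\mathbb{N}}I^\sharp_t(\mathbf{a}|_{(0,t]})=\lim_{t\to\infty}I^\sharp_t(\mathbf{a}|_{(0,t]})$ for $\mathbf{a}\in\mathcal{D}^K_{\boldsymbol{\mu}}$; (ii) for every $t\in\mathbb{N}$, $I^\sharp_t$ is continuous on $\mathbb{R}_+^{K\times t}$ in the product topology. Then for every $t\in\mathbb{N}$, the sequence of finite-horizon workloads under the work-conserving max-weight scheduler, $\{\mathbf{W}^L_{0,t}:=G^{\mathrm{wc}}_t(\mathbf{A}^L|_{(0,t]})\}_{L}$, satisfies an LDP on $\mathbb{R}_+^K$ with rate function $I_t$ given for $\mathbf{b}\in\mathbb{R}_+^K$ by $$I_t(\mathbf{b})=\inf\{I^\sharp_t(\mathbf{x}):\ \mathbf{x}\in\mathbb{R}_+^{K\times t},\ \mathbf{b}\in{}^{\mathbf{x}}G^{\mathrm{wc}}_t\}.$$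
   Context: Conventions: $\mathbb{N}=\{1,2,\dots\}$, $K\in\mathbb{N}$, $[\mathbf{x}]^+=\max\{\mathbf{0},\mathbf{x}\}$ coordinatewise; vector inequalities are coordinatewise. A set $\mathcal{R}\subset\mathbb{R}_+^K$ is coordinate-convex if $\boldsymbol{\mu}_1\in\mathcal{R}$, $\boldsymbol{\mu}_2\in\mathbb{R}_+^K$, $\boldsymbol{\mu}_2\le\boldsymbol{\mu}_1$ imply $\boldsymbol{\mu}_2\in\mathcal{R}$. $\mathrm{Proj}_{\mathcal{R}}$ is the (Euclidean) projection onto $\mathcal{R}$. Quasi-continuity: a function $F:\mathcal{X}\to\mathcal{Y}$ between complete metric spaces is quasi-continuous if for each $x\in\mathcal{X}$ there is a sequence $x_n\to x$ with $F(x_n)\to F(x)$ such that $F$ is continuous at every $x_n$. Cluster set: for $F:\mathcal{X}\to\mathcal{Y}$ and $x\in\mathcal{X}$, ${}^{x}F:=\{y\in\mathcal{Y}:\exists\,x_n\to x\text{ with }F(x_n)\to y\}$. Scheduler and workload: let $C_k=\max\{R^k:\mathbf{R}\in\mathcal{R}\}$. Fixed are quasi-continuous functions $H,H^{\mathrm{wc}}:\mathbb{R}_+^K\to\mathcal{R}$ with $H(\mathbf{w})\in\arg\max_{\mathbf{R}\in\mathcal{R}}\langle\mathbf{R},\mathbf{w}\rangle$ for all $\mathbf{w}$, $H^{\mathrm{wc}}(\mathbf{w})=\mathrm{Proj}_{\mathcal{R}}(\mathbf{w})$ if $\mathbf{w}\in\prod_{k=1}^K[0,C_k)$ and $H^{\mathrm{wc}}(\mathbf{w})=H(\mathbf{w})$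 otherwise (the work-conserving max-weight scheduling function). For arrivals $(\mathbf{a}_s)_{s\in\mathbb{N}}$, $\mathbf{a}_s\in\mathbb{R}_+^K$ being the work arriving at time $-s$, the workload at time $-s$, started from $\mathbf{W}_T=\mathbf{0}$ at time $-T$, evolves by $\mathbf{W}_{s-1}=[\mathbf{W}_s-H^{\mathrm{wc}}(\mathbf{W}_s)]^++\mathbf{a}_s$, $s=T,\dots,1$. With $\mathbf{a}|_{(m_1,m_2]}$ denoting $(\mathbf{a}_{m_1+1},\dots,\mathbf{a}_{m_2})$, $G^{\mathrm{wc}}_T:\mathbb{R}_+^{K\times T}\to\mathbb{R}_+^K$ maps $\mathbf{a}|_{(0,T]}$ to the workload $\mathbf{W}_0$ at time $0$. Sample-path space: for $x:\mathbb{N}\to\mathbb{R}_+$ put $x(0,t]=\sum_{s=1}^t x_s$. $\mathcal{D}$ is the set of such $x$ with $\|x\|_u:=\sup_{t\in\mathbb{N}}|x(0,t]/t|<\infty$, with metric $\|x-y\|_u=\sup_t|(x(0,t]-y(0,t])/t|$ (the scaled uniform topology). $\mathcal{D}_\mu:=\{x\in\mathcal{D}:\lim_{t\to\infty}x(0,t]/t=\mu\}$. For $\boldsymbol{\mu}=(\mu^1,\dots,\mu^K)\in\mathbb{R}_+^K$, $\mathcal{D}^K_{\boldsymbol{\mu}}:=\prod_k\mathcal{D}_{\mu^k}$, with the product topology (norm $\max_k\|a^k\|_u$). Arrivals: for each $L$, $\mathbf{A}^L=(A^{k,L},k=1,\dots,K)$ with $A^{k,L}=(A^{k,L}_t,t\in\mathbb{N})$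 a stationary $\mathbb{R}_+$-valued random sequence; arrivals to different queues are mutually independent; $\boldsymbol{\mu}$ is the vector of expected arrival rates. LDP: random elements $X^L$ of a Hausdorff space $\mathcal{X}$ with $\sigma$-algebra $\mathcal{B}$ (Borel) satisfy an LDP with (good) rate function $I:\mathcal{X}\to\mathbb{R}_+\cup\{\infty\}$ if all level sets $\{x:I(x)\le\alpha\}$, $\alpha\in\mathbb{R}$, are compact and, for every $B\in\mathcal{B}$ with interior $B^o$ and closure $\bar B$, $-\inf_{x\in B^o}I(x)\le\liminf_{L\to\infty}\frac1L\log P(X^L\in B)\le\limsup_{L\to\infty}\frac1L\log P(X^L\in B)\le-\inf_{x\in\bar B}I(x)$. A sample path LDP is an LDP for random sequences. *)

(* Defs.v *)
From HB Require Import structures.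
From mathcomp Require Import all_boot all_order all_algebra.
From mathcomp Require Import all_classical all_reals all_analysis.

Set Implicit Arguments.
Unset Strict Implicit.
Unset Printing Implicit Defensive.

Import Order.TTheory GRing.Theory Num.Theory.
Import numFieldNormedType.Exports.

Local Open Scope classical_set_scope.
Local Open Scope ring_scope.

(* Time is shifted by one throughout: index [s : nat] of a sequence, or row
   [s] of a matrix, is the arrival at time [-(s + 1)]; index [n : nat] of a
   family of processes is the scaling parameter [L = n + 1]. *)

Section quasi_continuity.
Context {X Y : topologicalType}.

Definition quasi_continuous (F : X -> Y) : Prop :=
  forall x, exists u : nat -> X,
    [/\ u n @[n --> \oo] --> x,
        F (u n) @[n --> \oo] --> F x &
        forall n, {for u n, continuous F}].

Definition cluster_set (F : X -> Y) (x : X) : set Y :=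
  [set y | exists u : nat -> X,
    u n @[n --> \oo] --> x /\ F (u n) @[n --> \oo] --> y].

End quasi_continuity.

Section orthant.
Context (R : realType) (m n : nat).

(* As a type (through [set_type]), the space of nonnegative [m x n] matrices
   carries the topology induced by the product topology of ['M_(m, n)]. *)
Definition orthant : set 'M[R]_(m, n) := [set x | forall i j, 0 <= x i j].

Definition mk_orthant (x : 'M[R]_(m, n)) (x0 : orthant x) :
  set_type orthant := SigSub (mem_set x0).

Lemma orthant_val (x : set_type orthant) : orthant (\val x).
Proof. exact: set_valP. Qed.

End orthant.
Arguments orthant : clear implicits.

(* [nnvec R K] is R_+^K.  [nnmat R K t] is R_+^{K x t}, stored with one row per
   time instant, so that a row is an element of [nnvec R K]. *)
Notation nnvec R K := (set_type (orthant R 1 K)).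
Notation nnmat R K t := (set_type (orthant R t K)).

Section scheduling.
Context {R : realType} {K : nat}.
Implicit Types (Rreg : set 'rV[R]_K) (r w : 'rV[R]_K).

Definition coordinate_convex Rreg : Prop :=
  forall r1 r2, Rreg r1 -> orthant R 1 K r2 ->
    (forall k, r2 0 k <= r1 0 k) -> Rreg r2.

Definition dotv r w : R := \sum_(k < K) r 0 k * w 0 k.

Definition norm2 w : R := Num.sqrt (dotv w w).

Definition is_argmax Rreg w r : Prop :=
  Rreg r /\ forall r', Rreg r' -> dotv r' w <= dotv r w.

(* [r] is the Euclidean projection of [w] onto [Rreg] (unique when [Rreg] is
   convex). *)
Definition is_proj Rreg w r : Prop :=
  Rreg r /\ forall r', Rreg r' -> norm2 (w - r) <= norm2 (w - r').

(* [C_k]; the supremum is attained when [Rreg] is compact and nonempty. *)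
Definition peak_rate Rreg (k : 'I_K) : R := sup [set r 0 k | r in Rreg].

Definition maxweight_scheduler Rreg (H : nnvec R K -> 'rV[R]_K) : Prop :=
  quasi_continuous H /\
  forall w : nnvec R K, is_argmax Rreg (\val w) (H w).

Definition work_conserving Rreg (H Hwc : nnvec R K -> 'rV[R]_K) : Prop :=
  quasi_continuous Hwc /\
  forall w : nnvec R K,
    let in_box := forall k, \val w 0 k < peak_rate Rreg k in
    (in_box -> is_proj Rreg (\val w) (Hwc w)) /\ (~ in_box -> Hwc w = H w).

End scheduling.

Section workload.
Context {R : realType} {K : nat}.

Lemma orthant0 : orthant R 1 K 0.
Proof. by move=> i j; rewrite mxE. Qed.

Lemma orthant_row t (x : nnmat R K t) (s : 'I_t) :
  orthant R 1 K (row s (\val x)).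
Proof. by move=> i j; rewrite mxE; exact: orthant_val. Qed.

Definition arrival t (x : nnmat R K t) (s : 'I_t) : nnvec R K :=
  mk_orthant (orthant_row x s).

Definition step_val (h a w : 'rV[R]_K) : 'rV[R]_K :=
  \row_k (Num.max 0 (w 0 k - h 0 k) + a 0 k).

Lemma orthant_step (h : 'rV[R]_K) (a w : nnvec R K) :
  orthant R 1 K (step_val h (\val a) (\val w)).
Proof.
by move=> i j; rewrite mxE addr_ge0 ?le_max ?lexx//; exact: orthant_val.
Qed.

Definition workload_step (S : nnvec R K -> 'rV[R]_K) (a w : nnvec R K) :
  nnvec R K := mk_orthant (orthant_step (S w) a w).

(* [foldr] consumes the oldest arrival (row [t - 1]) first, starting from the
   zero workload, and the arrival of row [0] last. *)
Definition workload (S : nnvec R K -> 'rV[R]_K) (t : nat) (x : nnmat R K t) :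
  nnvec R K :=
  foldr (fun s w => workload_step S (arrival x s) w)
    (mk_orthant orthant0) (enum 'I_t).

End workload.

Section sample_paths.
Context {R : realType}.
Implicit Types (x y : nat -> R).

(* [series x t] is [x(0,t]]. *)
Definition abs_averages x : set R :=
  [set `|series x t / t%:R| | t in [set t : nat | (0 < t)%N]].

Definition scaled_norm x : R := sup (abs_averages x).

Definition D_space : set (nat -> R) :=
  [set x | (forall s, 0 <= x s) /\ has_ubound (abs_averages x)].

Definition D_rate (mu : R) : set (nat -> R) :=
  [set x | D_space x /\ series x t / t%:R @[t --> \oo] --> mu].

Lemma abs_averages_neq0 x : abs_averages x !=set0.
Proof. by exists `|series x 1 / 1%:R|; exists 1%N. Qed.

Lemma abs_averagesB x y : has_ubound (abs_averages x) ->
  has_ubound (abs_averages y) -> has_ubound (abs_averages (x \- y)).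
Proof.
move=> [a ax] [b bx]; exists (a + b) => _ [t /= t0 <-].
have -> : series (x \- y) t = series x t - series y t.
  by rewrite /series/= sumrB.
rewrite mulrBl (le_trans (ler_normB _ _))// lerD//.
- by apply: ax; exists t.
- by apply: bx; exists t.
Qed.

Lemma scaled_norm_ub x t : has_ubound (abs_averages x) -> (0 < t)%N ->
  `|series x t / t%:R| <= scaled_norm x.
Proof. by move=> bx t0; apply: ub_le_sup => //; exists t. Qed.

End sample_paths.

(* Not a [set_type]: that would inherit the topology of pointwise convergence
   instead of the scaled uniform one. *)
Record rate_path (R : realType) (mu : R) := RatePath {
  path_fun :> nat -> R;
  path_funP : D_rate mu path_fun }.

Section scaled_uniform_metric.
Context {R : realType} (mu : R).
Implicit Types x y z : rate_path mu.

HB.instance Definition _ := gen_eqMixin (rate_path mu).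
HB.instance Definition _ := gen_choiceMixin (rate_path mu).

Definition rate_path_dist x y : R := scaled_norm (path_fun x \- path_fun y).

Let bounded x y : has_ubound (abs_averages (path_fun x \- path_fun y)).
Proof.
by apply: abs_averagesB; [have [[]] := path_funP x|have [[]] := path_funP y].
Qed.

Let seriesBE (x y : nat -> R) t : series (x \- y) t = series x t - series y t.
Proof. by rewrite /series/= sumrB. Qed.

Let dist_ub x y t : (0 < t)%N ->
  `|(series x t - series y t) / t%:R| <= rate_path_dist x y.
Proof. by move=> t0; rewrite -seriesBE; exact: scaled_norm_ub. Qed.

Let dist_le x y c : (forall t, (0 < t)%N ->
  `|(series x t - series y t) / t%:R| <= c) -> rate_path_dist x y <= c.
Proof.
move=> h; apply: ge_sup; first exact: abs_averages_neq0.
by move=> _ [t /= t0 <-]; rewrite seriesBE h.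
Qed.

Lemma rate_path_distxx x : rate_path_dist x x = 0.
Proof.
apply/eqP; rewrite eq_le; apply/andP; split.
  by apply: dist_le => t t0; rewrite subrr mul0r normr0.
by rewrite (le_trans _ (@dist_ub x x 1 isT)).
Qed.

Lemma rate_path_dist_sym x y : rate_path_dist x y = rate_path_dist y x.
Proof.
apply/eqP; rewrite eq_le; apply/andP; split; apply: dist_le => t t0;
  by rewrite -opprB mulNr normrN dist_ub.
Qed.

Lemma rate_path_dist_triangle y x z :
  rate_path_dist x z <= rate_path_dist x y + rate_path_dist y z.
Proof.
apply: dist_le => t t0.
have -> : series x t - series z t =
    (series x t - series y t) + (series y t - series z t).
  by rewrite addrA subrK.
by rewrite mulrDl (le_trans (ler_normD _ _))// lerD// dist_ub.
Qed.

Lemma rate_path_dist_eq0 x y : rate_path_dist x y = 0 -> x = y.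
Proof.
move=> xy0.
have E t : series x t = series y t.
  case: t => [|t]; first by rewrite /series/= !big_geq.
  have := @dist_ub x y t.+1 isT; rewrite xy0 normr_le0 mulf_eq0.
  by rewrite invr_eq0 pnatr_eq0 orbF subr_eq0 => /eqP.
have xy : path_fun x = path_fun y.
  apply/funext => s; have := E s.+1; have := E s.
  by rewrite /series/= !big_nat_recr//= => -> /addrI.
case: x y xy {xy0 E} => [x xP] [y yP] /= xy.
by rewrite xy in xP *; congr RatePath; exact: Prop_irrelevance.
Qed.

HB.instance Definition _ := isMetric.Build R (rate_path mu)
  rate_path_distxx rate_path_dist_eq0 rate_path_dist_sym
  rate_path_dist_triangle.

End scaled_uniform_metric.

Section path_vectors.
Context {R : realType} {K : nat} (mu : 'I_K -> R).

(* [D^K_mu]: product of the scaled uniform topologies. *)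
Definition rate_paths : topologicalType :=
  prod_topology (fun k : 'I_K => rate_path (mu k) : topologicalType).

Definition path_at (a : rate_paths) (k : 'I_K) (s : nat) : R :=
  path_fun (a k) s.

Lemma orthant_prefix t (a : rate_paths) :
  orthant R t K (\matrix_(s < t, k < K) path_at a k s).
Proof. by move=> s k; rewrite mxE; exact: (path_funP (a k)).1.1. Qed.

Definition path_prefix t (a : rate_paths) : nnmat R K t :=
  mk_orthant (@orthant_prefix t a).

End path_vectors.

Arguments path_prefix {R K mu} t a.

Section probability.
Local Open Scope ereal_scope.
Context {R : realType}.

Definition borel (E : topologicalType) : set_system E :=
  <<s [set U : set E | open U] >>.

Definition random_element d (Om : measurableType d) (E : topologicalType)
    (X : Om -> E) : Prop :=
  forall B, borel B -> measurable (X @^-1` B).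

Definition stationary d (Om : measurableType d) (P : probability Om R)
    (Y : nat -> Om -> R) : Prop :=
  forall (m : nat) (idx : 'I_m -> nat) (h : nat) (B : set 'rV[R]_m), borel B ->
    P [set w | B (\row_i Y (idx i + h)%N w)] =
    P [set w | B (\row_i Y (idx i) w)].

Definition sigma_process d (Om : measurableType d) (Y : nat -> Om -> R) :
    set_system Om :=
  <<s [set E | exists t (B : set R), borel B /\ E = Y t @^-1` B] >>.

Definition mutually_independent d (Om : measurableType d)
    (P : probability Om R) (K : nat) (Y : 'I_K -> nat -> Om -> R) : Prop :=
  forall (J : {set 'I_K}) (E : 'I_K -> set Om),
    (forall k, k \in J -> sigma_process (Y k) (E k)) ->
    P (\bigcap_(k in [set` J]) E k) = \prod_(k in J) P (E k).

(* Large deviation principle with good rate function [I] for the random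
   elements [X n], defined on possibly different probability spaces. *)
Definition LDP (d : nat -> measure_display)
    (Om : forall n, measurableType (d n)) (P : forall n, probability (Om n) R)
    (E : topologicalType) (X : forall n, Om n -> E) (I : E -> \bar R) : Prop :=
  [/\ forall x, 0 <= I x,
      forall c : R, compact [set x | I x <= c%:E] &
      forall B : set E, borel B ->
        let r n := (n.+1%:R^-1)%:E * lne (P n (X n @^-1` B)) in
        [/\ - ereal_inf (I @` B°) <= limn_einf r,
            limn_einf r <= limn_esup r &
            limn_esup r <= - ereal_inf (I @` closure B)]].

End probability.

(* Main.v *)
Require Import Defs.
From HB Require Import structures.
From mathcomp Require Import all_boot all_order all_algebra.
From mathcomp Require Import all_classical all_reals all_analysis.
From mathcomp Require Import ring lra.

Set Implicit Arguments.
Unset Strict Implicit.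
Unset Printing Implicit Defensive.

Import Order.TTheory GRing.Theory Num.Theory.
Import numFieldNormedType.Exports.

Local Open Scope classical_set_scope.
Local Open Scope ring_scope.

(** The workload at time 0 is a map [G] of the last [t] arrivals, and the
    claim is a contraction principle for a map that is only quasi-continuous.

    Suppose [X] obeys an LDP with a continuous rate function [I], and [F] is
    quasi-continuous and sends a neighbourhood of each compact set into a
    compact set. If [x] is a limit of points that [F] maps into [B], then by
    compactness [F] has a cluster value at [x] in the closure of [B]; so the
    upper bound for the closure of the preimage of [B] is the upper bound for
    [B]. If [F] has at [x] a cluster value in the interior of [B], then
    quasi-continuity provides continuity points of [F] arbitrarily close to [x]
    whose images are interior to [B], so [x] lies in the closure of the interior
    of the preimage of [B]; as [I] is continuous, its infimum over that open set
    is at most [I x], which gives the lower bound. The rate function is good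
    because its level sets are intersections of projections of the (closed)
    cluster graph over compact sets. This is [LDP_quasi_continuous].

    It remains to see that [G] is quasi-continuous, although compositions of
    quasi-continuous maps need not be. Two perturbed quantities have to be
    controlled: the work left over by the previous slot, and the arrivals, which
    must stay nonnegative. Both are handled by one property of the scheduler
    [S], [approached_from_above]: close to every [w] there is a continuity point
    [v] of [S], strictly larger than [w] in every coordinate, with [S v] close to
    [S w]. Given such a [v] for the workload [w] in some slot, all older arrivals
    are first perturbed so little that the work left over stays below [v]; the
    current arrival is then redefined as the difference, which is nonnegative,
    so that the workload becomes exactly [v]. Induction over the slots gives
    [unserved_quasi_continuous].

    The property itself holds for two different reasons
    ([work_conserving_from_above]). Where the scheduler is the Euclidean
    projection, it is Lipschitz, so any small increase of [w] will do. Where it is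
    max-weight, quasi-continuity only gives a continuity point [u] near [w], on
    no particular side; but the maximisers in direction [u] and in direction
    [c u] are the same, and continuity of the selection at a positive [u] forces
    all maximisers near [u] to be close to [H u]. Hence [c u] is again a continuity
    point with the same rate vector, and a factor [c] slightly above 1 pushes it
    above [w]. *)

(** * Pseudometric preliminaries *)

Section balls.
Context {R : realType}.

Lemma near_ball_continuous (T : topologicalType) (Y : pseudoMetricType R)
    (f : T -> Y) (a : T) :
  (forall e : R, 0 < e -> \forall b \near a, ball (f a) e (f b)) ->
  {for a, continuous f}.
Proof. by move=> h; apply/cvg_ballP => e; exact: h. Qed.

Lemma near_invS_le (e : R) : 0 < e ->
  \forall n \near \oo, (n.+1%:R^-1 : R) <= e.
Proof.
by move=> e0; apply: filterS (near_infty_natSinv_lt (PosNum e0)) => n /ltW.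
Qed.

Lemma continuous_atP (X Y : pseudoMetricType R) (F : X -> Y) (x : X) :
  {for x, continuous F} <-> forall e : R, 0 < e ->
    exists2 d : R, 0 < d & forall x', ball x d x' -> ball (F x) e (F x').
Proof.
split=> [Fx e e0|Fx].
  have /nbhs_ballP[d /= d0 dF] := Fx _ (nbhsx_ballx (F x) e e0).
  by exists d => // x' /dF.
apply: near_ball_continuous => e e0; have [d d0 dF] := Fx e e0.
by apply: filterS (nbhsx_ballx x d d0) => x' /dF.
Qed.

Lemma ball_mxP m n (x y : 'M[R]_(m, n)) e : 0 < e ->
  ball x e y <-> forall i j, `|y i j - x i j| < e.
Proof.
move=> e0; split=> [[_ xy] i j|xy]; first by rewrite distrC; exact: xy.
by split=> // i j; rewrite /ball/= distrC; exact: xy.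
Qed.

Lemma ball_rowP n (x y : 'rV[R]_n) e : 0 < e ->
  ball x e y <-> forall j, `|y 0 j - x 0 j| < e.
Proof.
move=> e0; rewrite ball_mxP//; split=> [xy j|xy i j]; first exact: xy.
by rewrite ord1; exact: xy.
Qed.

Lemma ball_orthantE m n (x y : set_type (orthant R m n)) e :
  ball x e y = ball (\val x) e (\val y).
Proof. by []. Qed.

Lemma positive_lower_bound (T : finType) (f : T -> R) :
  (forall k, 0 < f k) -> exists2 t : R, 0 < t & forall k, t < f k.
Proof.
move=> f0; near (0 : R)^'+ => t; exists t.
  by near: t; exact: nbhs_right_gt.
by near: t; apply: filter_forall => k; exact: nbhs_right_lt.
Unshelve. all: by end_near. Qed.

Lemma quasi_continuous_ballP (X Y : pseudoMetricType R) (F : X -> Y) :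
  (forall x (e : R), 0 < e -> exists x', [/\ ball x e x', ball (F x) e (F x') &
     {for x', continuous F}]) -> quasi_continuous F.
Proof.
move=> h x.
have /choice[u uP] n : exists x', [/\ ball x (n.+1%:R^-1 : R) x',
    ball (F x) (n.+1%:R^-1 : R) (F x') & {for x', continuous F}].
  by apply: h; rewrite invr_gt0.
exists u; split=> [||n]; last by have [] := uP n.
  apply/cvg_ballP => e e0; near=> n; have [+ _ _] := uP n.
  by apply: le_ball; near: n; exact: near_invS_le.
apply/cvg_ballP => e e0; near=> n; have [_ + _] := uP n.
by apply: le_ball; near: n; exact: near_invS_le.
Unshelve. all: by end_near. Qed.

Lemma ler_dist_max0 (a b : R) :
  `|Order.max 0 a - Order.max 0 b| <= `|a - b|.
Proof.
have [a0|a0] := leP a 0; have [b0|b0] := leP b 0.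
- by rewrite subrr normr0.
- rewrite sub0r normrN gtr0_norm// ltr0_norm ?subr_lt0 ?(le_lt_trans a0)//.
  by lra.
- by rewrite subr0 gtr0_norm// gtr0_norm ?subr_gt0 ?(le_lt_trans b0)//; lra.
- by [].
Qed.

End balls.

(** * Contraction principle for quasi-continuous maps *)

Section contraction.
Context {R : realType}.

Section cluster.
Context {X Y : pseudoMetricType R}.
Implicit Types (F : X -> Y) (x : X) (y : Y).

Lemma cluster_setP F x y : cluster_set F x y <->
  forall e : R, 0 < e -> exists x', ball x e x' /\ ball y e (F x').
Proof.
split=> [[u [ux Fuy]] e e0|h].
  near \oo => n; exists (u n); split.
    by near: n; exact: (cvg_ball ux).
  by near: n; exact: (cvg_ball Fuy).
have /choice[u uP] : forall n, exists x',
    ball x (n.+1%:R^-1 : R) x' /\ ball y (n.+1%:R^-1 : R) (F x').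
  by move=> n; apply: h; rewrite invr_gt0.
exists u; split; apply/cvg_ballP => e e0; near=> n.
  have [+ _] := uP n; apply: le_ball; near: n; exact: near_invS_le.
have [_ +] := uP n; apply: le_ball; near: n; exact: near_invS_le.
Unshelve. all: by end_near. Qed.

Definition cluster_graph F : set (X * Y) := [set p | cluster_set F p.1 p.2].

Lemma closed_cluster_graph F : closed (cluster_graph F).
Proof.
move=> [x y] clxy; apply/cluster_setP => e e0 /=.
have e20 : 0 < e / 2 by rewrite divr_gt0.
have [[x1 y1] [+ [/= b1 b2]]] := clxy _ (nbhsx_ballx (x, y) (e / 2) e20).
move=> /cluster_setP /(_ _ e20) [x' [/= h1 h2]]; exists x'.
by split; [exact: (ball_split b1)|exact: (ball_split b2)].
Qed.

(** The neighbourhoods make cluster values obey the same bound as values. The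
    bound is uniform over [A] because goodness of the new rate function needs one
    compact set for a whole level set of the old one. *)
Definition compactly_bounded F := forall A : set X, compact A ->
  exists2 C : set Y, compact C & forall x, A x -> \forall x' \near x, C (F x').

Lemma cluster_set_in F x y (C : set Y) : closed C ->
  (\forall x' \near x, C (F x')) -> cluster_set F x y -> C y.
Proof.
move=> Ccl Cx [u [ux Fuy]].
exact: (@closed_cvg _ _ _ _ (F \o u) C Ccl (ux _ Cx) _ Fuy).
Qed.

(** The images of the points of the preimage of [B] that approach [x] stay in
    a compact set, so they accumulate somewhere. *)
Lemma closure_preimage_cluster F (B : set Y) x : compactly_bounded F ->
  closure (F @^-1` B) x -> exists2 y, closure B y & cluster_set F x y.
Proof.
move=> Fbnd clx.
have [C cC /(_ x erefl) FC] := Fbnd [set x] (@compact_set1 _ x).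
pose G := F @ within (F @^-1` B) (nbhs x).
have PG : ProperFilter G.
  by apply: fmap_proper_filter; exact: within_nbhs_proper.
have GB : G B by exact: (@withinT _ (nbhs x) (F @^-1` B) _).
have [|y [Cy cly]] := cC G PG.
  by rewrite /G /fmap/= /within/=; apply: filterS FC.
exists y; first by move=> V /(cly _ _ GB).
apply/cluster_setP => e e0.
have Ge : G (F @` ball x e).
  rewrite /G /fmap/= /within/=; apply: filterS (nbhsx_ballx x e e0) => z bz _.
  by exists z.
have [_ [[z bz <-] bFz]] := cly _ _ Ge (nbhsx_ballx y e e0).
by exists z.
Qed.

(** A point [u n] close to [x] with [F (u n)] interior to [B] need not be
    interior to the preimage of [B], but a nearby continuity point [v m] is. *)
Lemma cluster_closure_interior F (B : set Y) x y : quasi_continuous F ->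
  B° y -> cluster_set F x y -> closure (F @^-1` B)° x.
Proof.
move=> Fqc By [u [ux Fuy]] V /= Vx.
near \oo => n.
have Vun : V° (u n) by near: n; exact: (ux _ (nbhs_interior Vx)).
have BFun : B°° (F (u n)).
  by near: n; exact: (Fuy _ (nbhs_interior (nbhs_interior By))).
have [v [vu Fvu Fcv]] := Fqc (u n).
near \oo => m.
exists (v m); split; last by near: m; exact: vu.
have BFv : B° (F (v m)) by near: m; exact: (Fvu _ BFun).
exact: (Fcv m _ BFv).
Unshelve. all: by end_near. Qed.

End cluster.

Lemma limn_esup_le (u v : nat -> \bar R) : (forall n, u n <= v n)%E ->
  (limn_esup u <= limn_esup v)%E.
Proof.
move=> uv; rewrite /limn_esup !limf_esupE.
apply: le_ereal_inf_tmp => _ [V FV <-].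
apply: ge_ereal_inf; exists (ereal_sup (u @` V)); first by exists V.
apply: ge_ereal_sup => _ [n Vn <-]; apply: le_trans (uv n) _.
by apply: ereal_sup_ubound; exists n.
Qed.

Lemma limn_einf_le (u v : nat -> \bar R) : (forall n, u n <= v n)%E ->
  (limn_einf u <= limn_einf v)%E.
Proof.
by move=> uv; rewrite /limn_einf leeN2; apply: limn_esup_le => n; rewrite leeN2.
Qed.

Lemma log_probability_le d (Om : measurableType d) (P : probability Om R) n
    (A B : set Om) : measurable A -> measurable B -> A `<=` B ->
  ((n.+1%:R^-1)%:E * lne (P A) <= (n.+1%:R^-1)%:E * lne (P B))%E.
Proof.
move=> mA mB AB; rewrite lee_pmul2l// ?lte_fin ?invr_gt0//.
rewrite lee_lne ?in_itv/= ?measure_ge0 ?leey//.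
by rewrite le_measure ?inE.
Qed.

Lemma borel_open (E : topologicalType) (U : set E) : open U -> borel U.
Proof. by move=> oU; apply: sub_gen_smallest. Qed.

Lemma borel_closed (E : topologicalType) (C : set E) : closed C -> borel C.
Proof.
move=> cC; rewrite -(setCK C) -setTD.
have [_ h _] := smallest_sigma_algebra [set: E] [set U : set E | open U].
by apply: h; apply: borel_open; exact: closed_openC.
Qed.

Section transform.
Context {X Y : pseudoMetricType R} (F : X -> Y) (I : X -> \bar R).

Definition cluster_rate (y : Y) : \bar R :=
  ereal_inf [set I x | x in [set x | cluster_set F x y]].

(** Over a compact level set of [I] the cluster graph is compact, hence so is
    its projection [S c']. Intersecting over all [c' > c] gives the level set of
    [cluster_rate] whether or not the infimum defining it is attained. *)
Lemma cluster_rate_level_compact (c : R) : hausdorff_space Y ->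
  compactly_bounded F -> (forall c' : R, compact [set x | (I x <= c'%:E)%E]) ->
  compact [set y | (cluster_rate y <= c%:E)%E].
Proof.
move=> Yhaus Fbnd Igood.
pose S (c' : R) := [set y | exists x, (I x <= c'%:E)%E /\ cluster_set F x y].
have cS c' : compact (S c').
  have [C cC FC] := Fbnd _ (Igood c').
  have clC : closed C by exact: compact_closed.
  have -> : S c' = snd @` (([set x | (I x <= c'%:E)%E] `*` C) `&`
                          cluster_graph F).
    apply/seteqP; split=> [y [x [Ix xy]]|_ [[x y] [[/= Ix Cy] xy] <-]].
      exists (x, y) => //; split=> //; split => //.
      exact: cluster_set_in (FC x Ix) xy.
    by exists x.
  apply: continuous_compact.
    by apply: continuous_subspaceT => p; exact: cvg_snd.
  apply: compact_closedI; last exact: closed_cluster_graph.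
  exact: compact_setX.
have -> : [set y | (cluster_rate y <= c%:E)%E] =
    \bigcap_(c' in [set c' | c < c']) S c'.
  apply/seteqP; split=> [y /= yc c' /= cc'|y Sy /=].
    have /ereal_inf_lt[_ [x xy <-] Ix] : (cluster_rate y < c'%:E)%E.
      by rewrite (le_lt_trans yc)// lte_fin.
    by exists x; split=> //; exact: ltW.
  apply/lee_addgt0Pr => e e0.
  have [|x [Ix xy]] := Sy (c + e); first by rewrite /= ltrDl.
  by rewrite -EFinD; apply: ge_ereal_inf; exists (I x) => //; exists x.
apply: (@subclosed_compact _ _ (S (c + 1))) => //.
  by apply: closed_bigI => c' _; exact: compact_closed.
by move=> y; apply; rewrite /= ltrDl.
Qed.

(** Continuity of [I] is what lets the infimum over the open set compete with
    the value at a point [x] of its closure. *)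
Lemma cluster_rate_interior (B : set Y) : quasi_continuous F -> continuous I ->
  (ereal_inf (I @` (F @^-1` B)°) <= ereal_inf (cluster_rate @` B°))%E.
Proof.
move=> Fqc Icont; apply: le_ereal_inf_tmp => _ [y By <-].
apply: le_ereal_inf_tmp => _ [x xy <-].
have clx := cluster_closure_interior Fqc By xy.
set O := _°.
rewrite leNgt; apply/negP => Ilt.
have [z [Oz Iz]] : O `&` [set z | (I z < ereal_inf (I @` O))%E] !=set0.
  apply: clx; have oO := @open_ereal_lt_ereal R (ereal_inf (I @` O)).
  exact: (Icont x _ (open_nbhs_nbhs (conj oO Ilt))).
by move: Iz; rewrite /= ltNge ereal_inf_lbound//; exists z.
Qed.

Lemma cluster_rate_closure (B : set Y) : compactly_bounded F ->
  (ereal_inf (cluster_rate @` closure B) <=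
   ereal_inf (I @` closure (F @^-1` B)))%E.
Proof.
move=> Fbnd; apply: le_ereal_inf_tmp => _ [x clx <-].
have [y By xy] := closure_preimage_cluster Fbnd clx.
apply: ge_ereal_inf; exists (cluster_rate y); first by exists y.
by apply: ge_ereal_inf; exists (I x) => //; exists x.
Qed.

(** [F] need not be Borel, so preimages of Borel sets are replaced by their
    interior and closure before the LDP of [Z] is applied. *)
Lemma LDP_quasi_continuous (d : nat -> measure_display)
    (Om : forall n, measurableType (d n)) (P : forall n, probability (Om n) R)
    (Z : forall n, Om n -> X) :
  hausdorff_space Y -> quasi_continuous F -> compactly_bounded F ->
  continuous I -> (forall n, random_element (Z n)) ->
  (forall n, random_element (fun w => F (Z n w))) ->
  LDP P Z I -> LDP P (fun n w => F (Z n w)) cluster_rate.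
Proof.
move=> Yhaus Fqc Fbnd Icont Zr FZr [I_ge0 Igood ldp]; split=> [y|c|B bB r].
- by apply: le_ereal_inf_tmp => _ [x _ <-].
- exact: cluster_rate_level_compact.
have bO := borel_open (open_interior (F @^-1` B)).
have bC := borel_closed (@closed_closure _ (F @^-1` B)).
have [+ _ _] := ldp _ bO; have [_ _ +] := ldp _ bC => upper lower; split.
- apply: le_trans (le_trans lower _).
    rewrite leeN2 ((interior_id (F @^-1` B)°).1 (open_interior _)).
    exact: cluster_rate_interior.
  apply: limn_einf_le => n; apply: log_probability_le.
  + exact: Zr.
  + exact: FZr.
  + by move=> w; exact: interior_subset.
- exact: limn_einf_sup.
- apply: le_trans _ (le_trans upper _); last first.
    rewrite leeN2 -((closure_id (closure (F @^-1` B))).1 (@closed_closure _ _)).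
    exact: cluster_rate_closure.
  apply: limn_esup_le => n; apply: log_probability_le.
  + exact: FZr.
  + exact: Zr.
  + by move=> w; exact: subset_closure.
Qed.

End transform.
End contraction.

(** * Monotonicity of maximisers and of the projection *)

Section inner_product.
Context {R : realType} {K : nat}.
Implicit Types (x y z r s w : 'rV[R]_K) (Rreg : set 'rV[R]_K) (e : R).

Lemma dotvC x y : dotv x y = dotv y x.
Proof. by apply: eq_bigr => k _; rewrite mulrC. Qed.

Lemma dotvDl x y z : dotv (x + y) z = dotv x z + dotv y z.
Proof. by rewrite -big_split; apply: eq_bigr => k _; rewrite mxE mulrDl. Qed.

Lemma dotvZl a x y : dotv (a *: x) y = a * dotv x y.
Proof.
by rewrite /dotv big_distrr/=; apply: eq_bigr => k _; rewrite mxE mulrA.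
Qed.

Lemma dotvDr x y z : dotv x (y + z) = dotv x y + dotv x z.
Proof. by rewrite dotvC dotvDl !(dotvC x). Qed.

Lemma dotvZr a x y : dotv x (a *: y) = a * dotv x y.
Proof. by rewrite dotvC dotvZl dotvC. Qed.

Lemma dotvNl x y : dotv (- x) y = - dotv x y.
Proof. by rewrite -scaleN1r dotvZl mulN1r. Qed.

Lemma dotvNr x y : dotv x (- y) = - dotv x y.
Proof. by rewrite dotvC dotvNl dotvC. Qed.

Lemma dotv_ge0 x : 0 <= dotv x x.
Proof. by apply: sumr_ge0 => k _; rewrite -expr2 sqr_ge0. Qed.

Definition dotvE := (dotvDl, dotvDr, dotvNl, dotvNr, dotvZl, dotvZr).

(** The hypothesis on the inner product is what monotonicity of the two
    scheduling rules provides; it bounds [x] by [y] in the Euclidean norm, which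
    is compared with the maximum norm that the topology uses. *)
Lemma dotv_bound x y e : dotv x x <= dotv y x ->
  (forall k, `|y 0 k| <= e) -> forall k, `|x 0 k| <= K%:R * e.
Proof.
move=> xy ye k.
have e0 : 0 <= e by apply: le_trans (ye k).
have xxyy : dotv x x <= dotv y y.
  by have := dotv_ge0 (x - y); rewrite !dotvE (dotvC x y); lra.
have yyK : dotv y y <= K%:R * e ^+ 2.
  have -> : K%:R * e ^+ 2 = \sum_(k < K) e ^+ 2.
    by rewrite sumr_const card_ord mulr_natl.
  apply: ler_sum => j _.
  by rewrite -expr2 -real_normK ?num_real// lerXn2r ?nnegrE.
have xkx : x 0 k ^+ 2 <= dotv x x.
  rewrite /dotv (bigD1 k)//= -expr2 lerDl sumr_ge0// => j _.
  by rewrite -expr2 sqr_ge0.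
have K1 : (1 : R) <= K%:R by rewrite ler1n (leq_ltn_trans _ (ltn_ord k)).
rewrite -(@ler_pXn2r _ 2)// ?nnegrE ?mulr_ge0//.
rewrite real_normK ?num_real// (le_trans xkx)// (le_trans xxyy)//.
by rewrite (le_trans yyK)// exprMn ler_wpM2r ?exprn_ge0// ler_eXnr.
Qed.

Lemma argmax_monotone Rreg w w' r r' : is_argmax Rreg w r ->
  is_argmax Rreg w' r' -> 0 <= dotv (r' - r) (w' - w).
Proof.
move=> [Rr wr] [Rr' wr']; have := wr _ Rr'; have := wr' _ Rr.
by rewrite !dotvE; lra.
Qed.

Lemma argmaxZ Rreg c w r : 0 < c ->
  is_argmax Rreg (c *: w) r -> is_argmax Rreg w r.
Proof.
move=> c0 [Rr wr]; split=> // r' /wr; rewrite !dotvE.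
by rewrite ler_pM2l.
Qed.

(** Moving from [r] a fraction [t] towards [r'] stays in the convex set and may
    not shorten the distance to [w]; compare the terms linear in [t]. *)
Lemma proj_variational Rreg w r r' : convex_set Rreg ->
  is_proj Rreg w r -> Rreg r' -> dotv (w - r) (r' - r) <= 0.
Proof.
move=> Rconv [Rr wr] Rr'.
set a := dotv _ _; pose b := dotv (r' - r) (r' - r).
have b0 : 0 <= b := dotv_ge0 _.
have ab t : 0 <= t -> t <= 1 -> 2 * a * t <= t ^+ 2 * b.
  move=> t0 t1.
  have : Rreg (t *: r' + (1 - t) *: r).
    by apply: set_mem; apply: (Rconv r' r (Itv01 t0 t1)); exact: mem_set.
  move=> /wr; rewrite /norm2 ler_sqrt ?dotv_ge0//.
  have -> : w - (t *: r' + (1 - t) *: r) = (w - r) + (- t) *: (r' - r).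
    by apply/rowP => k; rewrite !mxE; ring.
  rewrite [X in _ <= X](_ : _ = dotv (w - r) (w - r) - 2 * t * a + t ^+ 2 * b).
    by lra.
  rewrite /a /b; move: (w - r) (r' - r) => x y.
  by rewrite !dotvE (dotvC y x); ring.
rewrite leNgt; apply/negP => a0.
have ab0 : 0 < a + b by rewrite ltr_pwDl.
(* Any small enough positive t contradicts ab; this one is also at most 1. *)
have t0 : 0 <= a / (a + b) by rewrite divr_ge0 ?ltW.
have t1 : a / (a + b) <= 1 by rewrite ler_pdivrMr// mul1r lerDl.
have := ab _ t0 t1.
rewrite -(@ler_pM2r _ ((a + b) ^+ 2)) ?exprn_gt0//.
have -> : 2 * a * (a / (a + b)) * (a + b) ^+ 2 = 2 * a ^+ 2 * (a + b).
  by field; rewrite gt_eqF.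
have -> : (a / (a + b)) ^+ 2 * b * (a + b) ^+ 2 = a ^+ 2 * b.
  by field; rewrite gt_eqF.
have a20 : 0 < a ^+ 2 by rewrite exprn_gt0.
by have := mulr_gt0 a20 a0; have := mulr_ge0 (ltW a20) b0; nra.
Qed.

(** The variational inequalities at [w] and [w'], tested with each other's
    projection, add up to the hypothesis of [dotv_bound]. *)
Lemma proj_lipschitz Rreg w w' r r' e : convex_set Rreg ->
  is_proj Rreg w r -> is_proj Rreg w' r' ->
  (forall k, `|w' 0 k - w 0 k| <= e) ->
  forall k, `|r' 0 k - r 0 k| <= K%:R * e.
Proof.
move=> Rconv wr wr' ww' k.
have -> : r' 0 k - r 0 k = (r' - r) 0 k by rewrite !mxE.
apply: (@dotv_bound _ (w' - w)) => [|j]; last by rewrite !mxE.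
have := proj_variational Rconv wr wr'.1.
have := proj_variational Rconv wr' wr.1.
by rewrite !dotvE (dotvC r r'); lra.
Qed.

End inner_product.

(** * Approaching a workload vector from above *)

Section schedulers.
Context {R : realType} {K : nat}.
Implicit Types (Rreg : set 'rV[R]_K) (H S : nnvec R K -> 'rV[R]_K)
  (u v w : nnvec R K) (x s : 'rV[R]_K) (e d c : R).

Lemma dim_scale_lt e : 0 < e -> K%:R * (e / (K%:R + 1)) < e.
Proof.
move=> e0; rewrite mulrA ltr_pdivrMr ?ltr_wpDl//.
by rewrite mulrDr mulr1 (mulrC e) ltrDl.
Qed.

(** A selection of maximisers that varies little controls all maximisers: if [s]
    maximises in direction [x], then the maximiser in the direction [x] tilted
    slightly towards [s - H v] can only go further along [s - H v] than [s]
    itself, and it is one of the values of [H] near [v]. The bound [d <= v k]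
    keeps the tilted direction in the orthant. *)
Lemma argmax_near Rreg H v e d : (forall w, is_argmax Rreg (\val w) (H w)) ->
  (forall k, d <= \val v 0 k) ->
  (forall w, ball v d w -> forall k, `|H w 0 k - H v 0 k| <= e) ->
  forall x s, (forall k, `|x 0 k - \val v 0 k| < d) -> is_argmax Rreg x s ->
  forall k, `|s 0 k - H v 0 k| <= K%:R * e.
Proof.
move=> Hmax dv Hve x s xv xs k0.
have d0 : 0 < d := le_lt_trans (normr_ge0 _) (xv k0).
have -> : s 0 k0 - H v 0 k0 = (s - H v) 0 k0 by rewrite !mxE.
pose z := s - H v; rewrite -/z.
have [t t0 tP] : exists2 t : R, 0 < t &
    forall k : 'I_K, t < (d - `|x 0 k - \val v 0 k|) / (1 + `|z 0 k|).
  by apply: positive_lower_bound => k; rewrite divr_gt0 ?subr_gt0// ltr_pwDl.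
pose y := x + t *: z.
have yv k : `|y 0 k - \val v 0 k| < d.
  have zk0 : 0 < 1 + `|z 0 k| by rewrite ltr_pwDl.
  have := tP k; rewrite ltr_pdivlMr// => tzk.
  have -> : y 0 k - \val v 0 k = (x 0 k - \val v 0 k) + t * z 0 k.
    by rewrite !mxE; ring.
  rewrite (le_lt_trans (ler_normD _ _))// normrM gtr0_norm//.
  by move: tzk; rewrite mulrDr mulr1; lra.
have y0 : orthant R 1 K y.
  move=> i k; rewrite ord1; have := yv k; have := dv k; rewrite ltr_norml.
  by lra.
pose w := mk_orthant y0.
have vw : ball v d w by rewrite ball_orthantE; apply/ball_rowP.
apply: (@dotv_bound _ _ _ (H w - H v)) => [|j]; last first.
  by have := Hve w vw j; rewrite !mxE.
have := argmax_monotone xs (Hmax w).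
have -> : \val w - x = t *: z by rewrite /= /y addrC addKr.
rewrite dotvZr pmulr_rge0// => h.
have -> : H w - H v = (H w - s) + z by rewrite /z addrA subrK.
by rewrite dotvDl lerDr.
Qed.

(** Scaling the direction does not change the maximisers, and near [v] they are
    all close to [H v] by [argmax_near]; so values of [H] near [c *: v] are close
    to [H v], including the value at [c *: v] itself. *)
Lemma argmax_scale_continuous Rreg H v c w :
  (forall w, is_argmax Rreg (\val w) (H w)) -> {for v, continuous H} ->
  (forall k, 0 < \val v 0 k) -> 0 < c -> \val w = c *: \val v ->
  H w = H v /\ {for w, continuous H}.
Proof.
move=> Hmax Hv v0 c0 wcv.
have [d0 d00 d0v] := positive_lower_bound v0.
have near_w e : 0 < e -> exists2 d, 0 < d & forall u, ball w d u ->
    forall k, `|H u 0 k - H v 0 k| < e.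
  move=> e0; pose e1 := e / (K%:R + 1).
  have K0 : 0 < K%:R + 1 :> R by rewrite ltr_wpDl.
  have e10 : 0 < e1 by rewrite divr_gt0.
  have [d1 d10 d1H] := (continuous_atP H v).1 Hv e1 e10.
  pose d := Order.min d0 d1.
  have d_gt0 : 0 < d by rewrite lt_min d00.
  exists (c * d); first by rewrite mulr_gt0.
  move=> u; rewrite ball_orthantE ball_rowP ?mulr_gt0// => wu k.
  have ucv j : `|(c^-1 *: \val u) 0 j - \val v 0 j| < d.
    rewrite mxE -(@ltr_pM2l _ c)//; move: (wu j); rewrite wcv mxE.
    rewrite -[X in X * `|_|](gtr0_norm c0) -normrM mulrBr mulrA mulfV ?gt_eqF//.
    by rewrite mul1r.
  have ua : is_argmax Rreg (c^-1 *: \val u) (H u).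
    by apply: (argmaxZ c0); rewrite scalerA mulfV ?gt_eqF// scale1r.
  apply: le_lt_trans (argmax_near Hmax _ _ ucv ua k) _; last first.
  - exact: dim_scale_lt.
  - move=> z vz j; apply/ltW; move: j; apply/ball_rowP => //; apply: d1H.
    by apply: le_ball vz; rewrite ge_min lexx orbT.
  - by move=> j; rewrite ge_min (ltW (d0v j)).
have Hwv : H w = H v.
  apply/rowP => k; apply/eqP; rewrite -subr_eq0 -normr_le0 leNgt.
  apply/negP => /near_w[d d_gt0 /(_ w (ballxx w d_gt0) k)].
  by rewrite ltxx.
split=> //; apply/continuous_atP => e e0; have [d d_gt0 dH] := near_w e e0.
by exists d => // u wu; apply/ball_rowP => // k; rewrite Hwv; exact: dH.
Qed.

(** Quasi-continuity is used twice: for a continuity point [u] near [w], which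
    may lie on the boundary of the orthant, and then at a point [z] of the
    interior so close to [u] that [H z] is still close to [H u]. *)
Lemma quasi_continuous_interior H w e : quasi_continuous H -> 0 < e ->
  exists v, [/\ forall k, 0 < \val v 0 k,
    forall k, `|\val v 0 k - \val w 0 k| < e,
    ball (H w) e (H v) & {for v, continuous H}].
Proof.
move=> Hqc e0.
have Hnear u e' : 0 < e' -> exists v, [/\ ball u e' v, ball (H u) e' (H v) &
    {for v, continuous H}].
  move=> e'0; have [f [fu Hfu fc]] := Hqc u; near \oo => n; exists (f n).
  by split=> //; near: n; [exact: (cvg_ball fu)|exact: (cvg_ball Hfu)].
have e30 : 0 < e / 3 by rewrite divr_gt0.
have [u [wu Hwu uc]] := Hnear w _ e30.
have [d d0 dH] := (continuous_atP H u).1 uc _ e30.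
pose d1 := Order.min (d / 2) (e / 3).
have d10 : 0 < d1 by rewrite lt_min e30 divr_gt0.
have [d1d d1e] : d1 <= d / 2 /\ d1 <= e / 3.
  by split; rewrite ge_min lexx ?orbT.
have x0 : orthant R 1 K (\val u + const_mx d1).
  by move=> i j; rewrite !mxE addr_ge0 ?(ltW d10)//; exact: orthant_val.
pose z := mk_orthant x0.
have [v [zv Hzv vc]] := Hnear z d1 d10.
have zvk k : `|\val v 0 k - \val u 0 k - d1| < d1.
  move: zv; rewrite ball_orthantE ball_rowP// => /(_ k) /=.
  by rewrite !mxE opprD addrA.
exists v; split=> //.
- move=> k; have := zvk k; have := orthant_val u 0 k; rewrite ltr_norml.
  by lra.
- move=> k; move: wu; rewrite ball_orthantE ball_rowP// => /(_ k).
  by have := zvk k; rewrite !ltr_norml; lra.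
- apply/ball_rowP => // k.
  have uz : ball u d z.
    rewrite ball_orthantE ball_rowP// => j.
    rewrite /= !mxE addrAC subrr add0r gtr0_norm//.
    by rewrite (le_lt_trans d1d)// ltr_pdivrMr// ltr_pMr// ltr1n.
  have /ball_rowP-/(_ e30 k) := dH z uz.
  have /ball_rowP-/(_ d10 k) := Hzv.
  have /ball_rowP-/(_ e30 k) := Hwu.
  by rewrite !ltr_norml; lra.
Unshelve. all: by end_near. Qed.

(** Strictness leaves room for perturbing the work carried over from earlier
    slots; in coordinates where [w] vanishes it amounts to positivity. *)
Definition approached_from_above S w := forall e, 0 < e -> exists v,
  [/\ forall k, \val w 0 k < \val v 0 k, ball w e v, ball (S w) e (S v) &
      {for v, continuous S}].

Lemma maxweight_from_above Rreg H w : maxweight_scheduler Rreg H ->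
  approached_from_above H w.
Proof.
move=> [Hqc Hmax] e e0.
(* The scaling factor is 1 + t: bounding t (w k + 1) keeps the scaled point
   within e of w. *)
have [t t0 tP] : exists2 t : R, 0 < t &
    forall k : 'I_K, t < Order.min 1 (e / 4 / (\val w 0 k + 1)).
  apply: positive_lower_bound => k; rewrite lt_min ltr01/= !divr_gt0//.
  by rewrite ltr_wpDl//; exact: orthant_val.
(* In coordinates with w k > 0, an error below t w k / 2 is made up for by the
   factor 1 + t; where w k = 0, positivity of v k suffices, hence the dummy 1. *)
have [e1 e10 e1P] : exists2 e1 : R, 0 < e1 &
    forall k : 'I_K, e1 < Order.min (e / 4)
      (if \val w 0 k == 0 then 1 else t / 2 * \val w 0 k).
  apply: positive_lower_bound => k; rewrite lt_min divr_gt0//=.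
  case: eqP => [_//|/eqP wk]; rewrite mulr_gt0 ?divr_gt0// lt_neqAle eq_sym wk.
  exact: orthant_val.
pose e2 := Order.min e1 e.
have e20 : 0 < e2 by rewrite lt_min e10.
have [v [v0 wv Hwv vc]] := quasi_continuous_interior w Hqc e20.
have c0 : 0 < 1 + t by rewrite addr_gt0.
have y0 : orthant R 1 K ((1 + t) *: \val v).
  by move=> i j; rewrite mxE mulr_ge0 ?(ltW c0)//; exact: orthant_val.
pose y := mk_orthant y0.
have [Hyv yc] := argmax_scale_continuous Hmax vc v0 c0 (erefl : \val y = _).
have wk k : [/\ 0 <= \val w 0 k, t < 1, t * (\val w 0 k + 1) < e / 4 &
    e2 <= e1 /\ e1 < e / 4].
  have := tP k; rewrite lt_min => /andP[t1]; have w0 := orthant_val w 0 k.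
  have wk0 : 0 < \val w 0 k + 1 by rewrite ltr_wpDl.
  rewrite ltr_pdivlMr// => tw; split=> //.
  by split; [rewrite ge_min lexx|have := e1P k; rewrite lt_min => /andP[]].
exists y; split.
- move=> k; have [w0 t1 tw [e21 e14]] := wk k.
  rewrite mxE; have := e1P k; rewrite lt_min => /andP[_].
  case: eqP => [->_|_ e1w]; first by rewrite mulr_gt0.
  by have := wv k; rewrite ltr_norml => /andP[h _]; nra.
- rewrite ball_orthantE; apply/ball_rowP => // k; rewrite mxE.
  have [w0 t1 tw [e21 e14]] := wk k.
  by have := wv k; rewrite !ltr_norml => /andP[h1 h2]; apply/andP; split; nra.
- by rewrite Hyv; apply: le_ball Hwv; rewrite ge_min lexx orbT.
- exact: yc.
Qed.

(** Inside the box of peak rates the projection is Lipschitz. Outside it, some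
    coordinate of [w] reaches its peak rate; points above [w] exceed that rate
    strictly, so the scheduler agrees with [H] in a whole neighbourhood of the
    point provided by [maxweight_from_above]. *)
Lemma work_conserving_from_above Rreg H S w : convex_set Rreg ->
  maxweight_scheduler Rreg H -> work_conserving Rreg H S ->
  approached_from_above S w.
Proof.
move=> Rconv Hmw [_ SP] e e0.
pose box u := forall k, \val u 0 k < peak_rate Rreg k.
have K0 : 0 < K%:R + 1 :> R by rewrite ltr_wpDl.
have [wbox|wbox] := pselect (box w).
  have [t t0 tP] : exists2 t : R, 0 < t & forall k : 'I_K,
      t < Order.min ((peak_rate Rreg k - \val w 0 k) / 2) (e / (K%:R + 1)).
    by apply: positive_lower_bound => k; rewrite lt_min !divr_gt0// subr_gt0.
  have proj u : box u -> is_proj Rreg (\val u) (S u) by move=> /(SP u).1.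
  have x0 : orthant R 1 K (\val w + const_mx t).
    by move=> i j; rewrite !mxE addr_ge0 ?(ltW t0)//; exact: orthant_val.
  pose v := mk_orthant x0.
  have gap k : \val v 0 k + t < peak_rate Rreg k.
    by have := tP k; rewrite lt_min !mxE => /andP[+ _]; lra.
  have vbox : box v by move=> k; rewrite (lt_trans _ (gap k))// ltrDl.
  have vw k : `|\val v 0 k - \val w 0 k| = t.
    by rewrite /= !mxE addrAC subrr add0r gtr0_norm.
  exists v; split.
  - by move=> k; rewrite !mxE ltrDl.
  - rewrite ball_orthantE; apply/ball_rowP => // k; rewrite vw.
    have := tP k; rewrite lt_min => /andP[_ /lt_le_trans]; apply.
    by rewrite ler_pdivrMr// ler_peMr ?(ltW e0)// lerDr.
  - apply/ball_rowP => // k; apply: le_lt_trans _ (dim_scale_lt e0).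
    apply: proj_lipschitz (proj _ wbox) (proj _ vbox) _ k => // j.
    by rewrite vw; apply/ltW; have := tP j; rewrite lt_min => /andP[].
  - apply/continuous_atP => e' e'0.
    pose d := Order.min t (e' / (K%:R + 1)).
    have d0 : 0 < d by rewrite lt_min t0 divr_gt0.
    exists d => // u; rewrite ball_orthantE ball_rowP// => vu.
    have ubox : box u.
      move=> k; have := gap k; have := vu k; rewrite lt_min => /andP[].
      by rewrite ltr_norml; lra.
    apply/ball_rowP => // k.
    apply: le_lt_trans _ (dim_scale_lt e'0).
    apply: proj_lipschitz (proj _ vbox) (proj _ ubox) _ k => // j.
    by apply/ltW/(lt_le_trans (vu j)); rewrite ge_min lexx orbT.
have [v [wv bwv HSv vc]] := maxweight_from_above w Hmw e0.
have SH u : ~ box u -> S u = H u by move=> /(SP u).2.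
have {wbox} /existsNP[k /negP] := wbox; rewrite -leNgt => wk.
have near_v : exists2 d, 0 < d & forall u, ball v d u -> S u = H u.
  exists (\val v 0 k - \val w 0 k); first by rewrite subr_gt0.
  move=> u; rewrite ball_orthantE ball_rowP ?subr_gt0// => /(_ k) vu.
  apply: SH => /(_ k); move: vu; rewrite ltr_norml; lra.
have [d d0 dSH] := near_v.
have SHv : S v = H v by apply: dSH; exact: ballxx.
have SHw : S w = H w by apply: SH => /(_ k); rewrite ltNge wk.
exists v; split=> //; first by rewrite SHv SHw.
apply/continuous_atP => e' e'0.
have [d' d'0 dH] := (continuous_atP H v).1 vc e' e'0.
exists (Order.min d d'); first by rewrite lt_min d0.
move=> u vu; rewrite SHv dSH.
  by apply: dH; apply: le_ball vu; rewrite ge_min lexx orbT.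
by apply: le_ball vu; rewrite ge_min lexx.
Qed.

Lemma work_conserving_mem Rreg H S w :
  maxweight_scheduler Rreg H -> work_conserving Rreg H S -> Rreg (S w).
Proof.
move=> [_ Hmax] [_ /(_ w)[proj maxw]].
by have [/proj[]|/maxw ->] := pselect (forall k, \val w 0 k < peak_rate Rreg k);
  last exact: (Hmax w).1.
Qed.

End schedulers.

(** * Quasi-continuity of the workload *)

Section workload_map.
Context {R : realType} {K t : nat} (S : nnvec R K -> 'rV[R]_K).
Implicit Types (x y : nnmat R K t) (l : seq 'I_t) (w v : nnvec R K) (e d : R).

(** The induction over slots tracks this quantity rather than the workload. In
    the initial state it does not depend on the arrivals, so that a discontinuity
    of [S] at 0 is harmless; later, a change of the next arrival compensates for
    a change of it. *)
Definition unserved w : 'rV[R]_K := \row_k Order.max 0 (\val w 0 k - S w 0 k).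

(** An induction over slots needs an arbitrary duplicate-free list of slots in
    place of [enum 'I_t]. *)
Definition workload_after x l : nnvec R K :=
  foldr (fun s w => workload_step S (arrival x s) w) (mk_orthant orthant0) l.

Lemma workload_after_cons x s l k : \val (workload_after x (s :: l)) 0 k =
  unserved (workload_after x l) 0 k + \val x s k.
Proof. by rewrite /= !mxE. Qed.

Lemma eq_workload_after x y l :
  (forall s, s \in l -> forall k, \val x s k = \val y s k) ->
  workload_after x l = workload_after y l.
Proof.
elim: l => [//|s l IHl] xy; apply: val_inj; apply/rowP => k.
rewrite !workload_after_cons IHl ?xy ?mem_head// => r rl.
by apply: xy; rewrite in_cons rl orbT.
Qed.

Lemma unserved_near w v e :
  (forall k, `|\val v 0 k - \val w 0 k| < e / 2) ->
  (forall k, `|S v 0 k - S w 0 k| < e / 2) ->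
  forall k, `|unserved v 0 k - unserved w 0 k| < e.
Proof.
move=> vw Svw k; rewrite !mxE (le_lt_trans (ler_dist_max0 _ _))//.
by have := vw k; have := Svw k; rewrite !ltr_norml; lra.
Qed.

Definition rows_near l x y d :=
  forall s, s \in l -> forall k, `|\val y s k - \val x s k| < d.

(** The point [v] above the workload [w] of slot [s] is chosen before the older
    arrivals are perturbed, so that the perturbation can be made smaller than the
    gap between [v] and [w]; the arrival of slot [s] then brings the workload to
    [v] exactly. Continuity at [x'] is stated with respect to the rows in [l]
    only, so that it survives the later change of row [s]. *)
Lemma unserved_quasi_continuous l x e :
  (forall w, approached_from_above S w) -> uniq l -> 0 < e ->
  exists x', [/\ forall s k, `|\val x' s k - \val x s k| < e,
    forall k, `|unserved (workload_after x' l) 0 k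
               - unserved (workload_after x l) 0 k| < e &
    forall e', 0 < e' -> exists2 d, 0 < d & forall y, rows_near l x' y d ->
      forall k, `|unserved (workload_after y l) 0 k
                 - unserved (workload_after x' l) 0 k| < e'].
Proof.
move=> above; elim: l e => [|s l IHl] e.
  move=> _ e0; exists x; split.
  - by move=> s k; rewrite subrr normr0.
  - by move=> k; rewrite subrr normr0.
  - by move=> e' e'0; exists 1 => // y _ k; rewrite subrr normr0.
rewrite cons_uniq => /andP[sl ul] e0.
set w := workload_after x (s :: l).
have e20 : 0 < e / 2 by rewrite divr_gt0.
have [v [wv + + vc]] := above w _ e20.
rewrite ball_orthantE !ball_rowP// => bwv bSwv.
have [g g0 gP] : exists2 g : R, 0 < g &
    forall k : 'I_K, g < \val v 0 k - \val w 0 k.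
  by apply: positive_lower_bound => k; rewrite subr_gt0.
pose g' := Order.min g (e / 2).
have g'0 : 0 < g' by rewrite lt_min g0.
have [g'g g'e] : g' <= g /\ g' <= e / 2 by split; rewrite ge_min lexx ?orbT.
have [x1 [xx1 Ux1 cx1]] := IHl g' ul g'0.
pose U z := unserved (workload_after z l).
pose m := \matrix_(i < t, k < K)
  (if i == s then \val v 0 k - U x1 0 k else \val x1 i k).
have vU k : \val v 0 k - U x1 0 k - \val x s k =
    (\val v 0 k - \val w 0 k) - (U x1 0 k - U x 0 k).
  by rewrite workload_after_cons -/(U x); ring.
have m0 : orthant R t K m.
  move=> i k; rewrite mxE; case: ifP => _; last exact: orthant_val.
  have := Ux1 k; rewrite -/(U x1) -/(U x); have := gP k.
  have := orthant_val x s k; have := vU k; rewrite ltr_norml; lra.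
pose x' := mk_orthant m0.
have x'E i k : \val x' i k = if i == s then \val v 0 k - U x1 0 k
    else \val x1 i k by rewrite /= mxE.
have x'l : workload_after x' l = workload_after x1 l.
  apply: eq_workload_after => r rl k; rewrite x'E.
  by case: eqP => // rs; rewrite -rs rl in sl.
have x'v : workload_after x' (s :: l) = v.
  apply: val_inj; apply/rowP => k; rewrite workload_after_cons x'l x'E eqxx.
  by rewrite addrC subrK.
exists x'; split.
- move=> i k; rewrite x'E; case: eqP => [->|_]; last first.
    by apply: lt_le_trans (xx1 i k) _; lra.
  rewrite vU; have := Ux1 k; rewrite -/(U x1) -/(U x); have := bwv k.
  by rewrite !ltr_norml; lra.
- by rewrite x'v; exact: unserved_near.
- move=> e' e'0; rewrite x'v.
  have e'20 : 0 < e' / 2 by rewrite divr_gt0.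
  have [d1 d10 d1S] := (continuous_atP S v).1 vc _ e'20.
  pose d2 := Order.min d1 (e' / 2).
  have d20 : 0 < d2 by rewrite lt_min d10.
  have [d2d1 d2e] : d2 <= d1 /\ d2 <= e' / 2.
    by split; rewrite ge_min lexx ?orbT.
  have [d3 d30 d3U] := cx1 (d2 / 2) ltac:(by rewrite divr_gt0).
  pose d := Order.min d3 (d2 / 2).
  have d0 : 0 < d by rewrite lt_min d30 divr_gt0.
  have [dd3 dd2] : d <= d3 /\ d <= d2 / 2 by split; rewrite ge_min lexx ?orbT.
  exists d => // y yx'.
  have yv k : `|\val (workload_after y (s :: l)) 0 k - \val v 0 k| < d2.
    have := yx' s (mem_head _ _) k.
    have : `|U y 0 k - U x1 0 k| < d2 / 2.
      apply: d3U => r rl j; have := yx' r _ j; rewrite in_cons rl orbT x'E.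
      case: eqP => [rs|_ /(_ isT) h]; first by rewrite -rs rl in sl.
      exact: lt_le_trans h dd3.
    rewrite workload_after_cons x'E eqxx -/(U y).
    by rewrite !ltr_norml; lra.
  apply: unserved_near => [k|].
    exact: lt_le_trans (yv k) d2e.
  apply/ball_rowP => //; apply: d1S; rewrite ball_orthantE ball_rowP// => k.
  exact: lt_le_trans (yv k) d2d1.
Qed.

Lemma workload_quasi_continuous : (forall w, approached_from_above S w) ->
  quasi_continuous (workload S (t := t)).
Proof.
move=> above; apply: quasi_continuous_ballP => x e e0.
have : uniq (enum 'I_t) := enum_uniq _.
rewrite /workload -/(workload_after _ _).
case: (enum _) => [_|s l /= /andP[sl ul]].
  exists x; split; [exact: ballxx|exact: ballxx|exact: cst_continuous].
have e20 : 0 < e / 2 by rewrite divr_gt0.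
have [x' [xx' Ux' cx']] := unserved_quasi_continuous x above ul e20.
exists x'; split.
- rewrite ball_orthantE ball_mxP// => i k.
  by apply: lt_le_trans (xx' i k) _; lra.
- rewrite ball_orthantE ball_rowP// => k; rewrite !mxE.
  have := Ux' k; have := xx' s k; rewrite !mxE !ltr_norml; lra.
- apply/continuous_atP => e' e'0; have e'20 : 0 < e' / 2 by rewrite divr_gt0.
  have [d d0 dU] := cx' _ e'20.
  exists (Order.min d (e' / 2)); first by rewrite lt_min d0.
  move=> y; rewrite !ball_orthantE ball_mxP ?lt_min ?d0// ball_rowP// => x'y k.
  have := dU y _ k; rewrite !mxE => h.
  have {}h := h _.
  have := x'y s k; rewrite lt_min => /andP[_].
  have : rows_near l x' y d.
    by move=> r _ j; have := x'y r j; rewrite lt_min => /andP[].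
  move=> /h; rewrite !ltr_norml; lra.
Qed.

End workload_map.

(** * Compactness and measurability *)

Section orthant_topology.
Context {R : realType}.

Lemma hausdorff_orthant m n : hausdorff_space (set_type (orthant R m n)).
Proof.
move=> x y xy; apply: val_inj; apply/matrixP => i j; apply/eqP.
rewrite -subr_eq0 -normr_le0 leNgt; apply/negP => d0.
have d20 : 0 < `|\val x i j - \val y i j| / 2 by rewrite divr_gt0.
have [z [xz yz]] := xy _ _ (nbhsx_ballx x _ d20) (nbhsx_ballx y _ d20).
have := xz.2 i j; have := yz.2 i j; rewrite /ball/=.
have := ler_distD (\val z i j) (\val x i j) (\val y i j).
by rewrite (distrC (\val y i j)); lra.
Qed.

Lemma orthant_clamp n (x : 'rV[R]_n) :
  orthant R 1 n (\row_k Order.max 0 (x 0 k)).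
Proof. by move=> i k; rewrite mxE le_max lexx. Qed.

(** The box is the image of a compact box of row vectors under the continuous
    retraction [clamp] onto the orthant. *)
Lemma compact_orthant_box n (M : R) :
  compact [set w : nnvec R n | forall k, \val w 0 k <= M].
Proof.
pose clamp (x : 'rV[R]_n) := mk_orthant (orthant_clamp x).
have clamp_cont : continuous clamp.
  move=> x; apply/continuous_atP => e e0.
  exists e => // y /ball_rowP-/(_ e0) xy.
  rewrite ball_orthantE ball_rowP// => k; rewrite !mxE.
  exact: le_lt_trans (ler_dist_max0 _ _) (xy k).
have -> : [set w : nnvec R n | forall k, \val w 0 k <= M] =
    clamp @` [set x : 'rV[R]_n | forall k, `[0, M]%classic (x 0 k)].
  apply/seteqP; split=> [w wM|_ [x xM <-] k].
    exists (\val w) => [k /=|].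
      by rewrite in_itv/= wM andbT; exact: orthant_val.
    apply: val_inj; apply/rowP => k; rewrite !mxE max_r//; exact: orthant_val.
  have := xM k; rewrite /= in_itv/= mxE => /andP[x0 xkM].
  by rewrite max_r.
apply: continuous_compact; first exact: continuous_subspaceT.
apply: (rV_compact (A := fun=> `[0, M]%classic)) => _.
exact: segment_compact.
Qed.

Lemma compact_orthant_bounded m n (A : set (set_type (orthant R m n))) :
  compact A -> exists M : R, forall x, A x -> forall i j, \val x i j <= M.
Proof.
move=> /compact_near_coveringP cA.
pose bounded M (x : set_type (orthant R m n)) := forall i j, \val x i j <= M.
have [|M AM] := @filter_ex _ _ _ _ (cA R +oo bounded _ _); last by exists M.
move=> x Ax.
have xM : \forall M \near +oo, forall i j, \val x i j + 1 <= M.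
  apply: filter_forall => i; apply: filter_forall => j.
  exact: nbhs_pinfty_ge (num_real _).
near=> y M => i j.
have xy : ball x 1 y by near: y; exact: nbhsx_ballx.
have yM : \val x i j + 1 <= M by move: i j; near: M.
by have := xy.2 i j; rewrite /ball/= ltr_norml; lra.
Unshelve. all: by end_near. Qed.

End orthant_topology.

Lemma workload_after_le (R : realType) (K t : nat) (S : nnvec R K -> 'rV[R]_K)
    (x : nnmat R K t) (l : seq 'I_t) (M : R) :
  (forall w k, 0 <= S w 0 k) -> (forall s k, \val x s k <= M) ->
  forall k, \val (workload_after S x l) 0 k <= (size l)%:R * M.
Proof.
move=> S0 xM k; elim: l => [|s l IHl]; first by rewrite /= mxE mul0r.
rewrite workload_after_cons /= -natr1 mulrDl mul1r lerD//.
rewrite mxE; apply: le_trans IHl.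
by rewrite ge_max orthant_val lerBlDr lerDl S0.
Qed.

Lemma workload_compactly_bounded (R : realType) (K t : nat)
    (S : nnvec R K -> 'rV[R]_K) : (forall w k, 0 <= S w 0 k) ->
  compactly_bounded (workload S (t := t)).
Proof.
move=> S0 A /compact_orthant_bounded[M AM].
exists [set w : nnvec R K |
    forall k, \val w 0 k <= (size (enum 'I_t))%:R * (M + 1)].
  exact: compact_orthant_box.
move=> x Ax; apply: filterS (nbhsx_ballx x _ ltr01) => y.
rewrite ball_orthantE ball_mxP// => xy k.
apply: workload_after_le => // s j.
by have := xy s j; have := AM _ Ax s j; rewrite ltr_norml; lra.
Qed.

Section prefixes.
Context {R : realType}.

(** An arrival is the difference of two consecutive cumulative sums, each within
    its time times the distance. *)
Lemma rate_path_coordinate (mu : R) (x y : rate_path mu) s :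
  `|path_fun x s - path_fun y s| <= (2 * s.+1)%:R * rate_path_dist x y.
Proof.
pose z := path_fun x \- path_fun y.
have bz : has_ubound (abs_averages z).
  by apply: abs_averagesB; [have [[]] := path_funP x|have [[]] := path_funP y].
have D0 : 0 <= rate_path_dist x y.
  exact: le_trans (normr_ge0 _) (@scaled_norm_ub _ z 1 bz isT).
have sz t : `|series z t| <= t%:R * rate_path_dist x y.
  case: t => [|t]; first by rewrite /series/= big_geq// normr0 mul0r.
  have := @scaled_norm_ub _ z t.+1 bz isT.
  by rewrite normrM normfV (@ger0_norm _ t.+1%:R)// ler_pdivrMr ?ltr0n// mulrC.
have -> : path_fun x s - path_fun y s = series z s.+1 - series z s.
  by rewrite /series/= big_nat_recr//= addrAC subrr add0r.
rewrite (le_trans (ler_normB _ _))// (le_trans (lerD (sz _) (sz _)))//.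
by rewrite -mulrDl ler_wpM2r// -natrD ler_nat mul2n -addnn leq_add2l.
Qed.

Lemma path_prefix_continuous K (mu : 'I_K -> R) t :
  continuous (path_prefix (mu := mu) t).
Proof.
move=> a; apply: near_ball_continuous => e e0.
pose d := e / (2 * t.+1)%:R.
have d0 : 0 < d by rewrite divr_gt0// ltr0n.
have : \forall b \near a, forall k, ball (a k) d (b k : rate_path (mu k)).
  apply: (filter_forall (nbhs_filter a)) => k.
  have := @proj_continuous _
    (fun k : 'I_K => rate_path (mu k) : topologicalType) k a.
  by move=> /(_ _ (nbhsx_ballx (a k : rate_path (mu k)) d d0)).
apply: filterS => b ab; rewrite ball_orthantE ball_mxP// => s k.
rewrite /= !mxE /path_at distrC (le_lt_trans (rate_path_coordinate _ _ _))//.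
have abk : rate_path_dist (a k) (b k) < d := ab k.
have t0 : 0 < (2 * t.+1)%:R :> R by rewrite ltr0n.
move: abk; rewrite ltr_pdivlMr// mulrC; apply: le_lt_trans.
rewrite ler_wpM2r//.
  have := le_trans (normr_ge0 _) (rate_path_coordinate (a k) (b k) 0).
  by rewrite pmulr_rge0 ?ltr0n.
by rewrite ler_nat leq_mul2l/= ltnW// ltnS.
Qed.

Lemma random_element_comp d (Om : measurableType d) (E E' : topologicalType)
    (X : Om -> E) (f : E -> E') : continuous f -> random_element X ->
  random_element (fun w => f (X w)).
Proof.
move=> /continuousP fc Xr B bB; rewrite -[X in measurable X]setTI.
suff: @borel E' `<=` image_set_system setT (fun w => f (X w)) measurable by exact.
apply: smallest_sub; first exact/sigma_algebra_image/sigma_algebra_measurable.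
move=> U oU; rewrite /image_set_system/= setTI.
by apply: (Xr (f @^-1` U)); apply: borel_open; exact: fc.
Qed.

End prefixes.

(** * The large deviation principle *)

Theorem theorem2 (R : realType) (K : nat) (hK : (0 < K)%N)
  (Rreg : set 'rV[R]_K)
  (Rreg_ge0 : Rreg `<=` orthant R 1 K)
  (Rreg_compact : compact Rreg)
  (Rreg_convex : convex_set Rreg)
  (Rreg_cconvex : coordinate_convex Rreg)
  (H Hwc : nnvec R K -> 'rV[R]_K)
  (H_mw : maxweight_scheduler Rreg H)
  (Hwc_wc : work_conserving Rreg H Hwc)
  (mu : 'I_K -> R) (mu_ge0 : forall k, 0 <= mu k)
  (d : nat -> measure_display) (Om : forall n, measurableType (d n))
  (P : forall n, probability (Om n) R)
  (A : forall n, Om n -> rate_paths mu)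
  (A_random : forall n, random_element (A n))
  (A_stationary : forall n k, stationary (P n) (fun s w => path_at (A n w) k s))
  (A_indep : forall n,
    mutually_independent (P n) (fun k s w => path_at (A n w) k s))
  (A_mean : forall n k s,
    'E_(P n)[fun w => path_at (A n w) k s]%E = (mu k)%:E)
  (I : rate_paths mu -> \bar R)
  (It : forall t : nat, nnmat R K t -> \bar R)
  (A_LDP : LDP P A I)
  (At_LDP : forall t : nat, (0 < t)%N ->
    LDP P (fun n w => path_prefix t (A n w)) (It t))
  (I_sup : forall a : rate_paths mu,
    I a = ereal_sup [set It t (path_prefix t a) | t in [set t : nat | (0 < t)%N]])
  (I_lim : forall a : rate_paths mu,
    It t (path_prefix t a) @[t --> \oo] --> I a)
  (It_continuous : forall t : nat, (0 < t)%N -> continuous (It t)) :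
  forall t : nat, (0 < t)%N ->
    (forall n, random_element (fun w => workload Hwc (path_prefix t (A n w)))) ->
    LDP P (fun n w => workload Hwc (path_prefix t (A n w)))
      (fun b : nnvec R K =>
         ereal_inf [set It t x | x in
           [set x : nnmat R K t | cluster_set (workload Hwc (t:=t)) x b]]).
Proof.
move=> t t0 Wr.
apply: (@LDP_quasi_continuous R (nnmat R K t) (nnvec R K)
  (workload Hwc (t := t))).
- exact: hausdorff_orthant.
- apply: workload_quasi_continuous => w.
  exact: work_conserving_from_above Rreg_convex H_mw Hwc_wc.
- apply: workload_compactly_bounded => w k.
  by apply: Rreg_ge0; exact: work_conserving_mem H_mw Hwc_wc.
- exact: It_continuous.
- by move=> n; apply: random_element_comp => //; exact: path_prefix_continuous.
- exact: Wr.
- exact: At_LDP.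
Qed.
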